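(* Let $(J,R,Q,B)$ be a minimal port-Hamiltonian system with $J,R,Q\in\mathbb{R}^{n,n}$, $B\in\mathbb{R}^{n,m}$, $m\le n$, put $A:=(J-R)Q$, $C:=B^{\mathsf T}Q$, and let $\gamma>1$. Let $P=\eta S$, where $\eta\in[0,\infty)$ and $S=S^{\mathsf T}\succ0$ solves the KYP linear matrix inequality $$\begin{bmatrix}-SA-A^{\mathsf T}S&C^{\mathsf T}-SB\\ C-B^{\mathsf T}S&0\end{bmatrix}\succeq0,$$ and assume that $(A+\gamma^{-2}Q^{-1}P,B)$ is stabilizable. Suppose that $(J,R,Q,B)$ is balanced with respect to the modified $\mathcal H_\infty$ filter equation $$A\tilde Y+\tilde YA^{\mathsf T}+\tilde Y\big((\gamma^{-2}-1)C^{\mathsf T}C+\gamma^{-2}P\big)\tilde Y+(1-\gamma^{-2})BB^{\mathsf T}+2R-\gamma^{-2}Q^{-1}PQ^{-1}=0$$ and the modified $\mathcal H_\infty$ control equation $$\big(A+\gamma^{-2}\tilde Y(C^{\mathsf T}C+P)\big)^{\mathsf T}\tilde X+\tilde X\big(A+\gamma^{-2}\tilde Y(C^{\mathsf T}C+P)\big)-(1-\gamma^{-2})\tilde XBB^{\mathsf T}\tilde X+C^{\mathsf T}C+P=0,$$ and partition (for some $1\le r<n$, with $(1,1)$-blocks of size $r\times r$ and $B_1$ having $r$ rows) $$J=\begin{bmatrix} J_{11} & J_{12} \\ J_{21} & J_{22} \end{bmatrix},\quad R=\begin{bmatrix} R_{11} & R_{12} \\ R_{21} & R_{22} \end{bmatrix},\quad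 Q=\begin{bmatrix} Q_{11} & Q_{12} \\ Q_{21} & Q_{22} \end{bmatrix},\quad B=\begin{bmatrix} B_1 \\ B_2 \end{bmatrix}.$$ Then the system $(J_{11},R_{11},Q_{11},B_1)$ is port-Hamiltonian. In particular, truncation of $((J-R)Q,\,B,\,B^{\mathsf T}Q)$ preserves the port-Hamiltonian structure; that is, the truncated system $(A_{11},B_1,C_1)$, with $A_{11}$ the leading $r\times r$ block of $A$ and $C_1$ the first $r$ columns of $C$, is port-Hamiltonian.
   Context: All matrices are real. $M\succeq0$ (resp. $M\succ0$) means symmetric positive semidefinite (resp. definite). A linear system $(A,B,C)$ denotes $\dot x=Ax+Bu$, $y=Cx$. It is minimal if $(A,B)$ is controllable and $(A,C)$ is observable. A port-Hamiltonian system $(J,R,Q,B)$ (without feedthrough) is given by $J=-J^{\mathsf T}$, $R=R^{\mathsf T}\succeq0$, $Q=Q^{\mathsf T}\succ0$ and $B$, and denotes the linear system $\dot x=(J-R)Qx+Bu$, $y=B^{\mathsf T}Qx$. It is called minimal if $((J-R)Q,B,B^{\mathsf T}Q)$ is minimal. A linear system $(A,B,C)$ is called port-Hamiltonian if there are such $J,R,Q$ with $A=(J-R)Q$ and $C=B^{\mathsf T}Q$. The solution of the filter equation that is used is $\tilde Y=Q^{-1}$. The solution of the control equation (with this $\tilde Y$) that is used is the positive definite stabilizing solution $\tilde X$, where stabilizing means that all eigenvalues of $A+\gamma^{-2}\tilde Y(C^{\mathsf T}C+P)-(1-\gamma^{-2})BB^{\mathsf T}\tilde X$ have negative real part. The system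 is balanced with respect to the two equations if it is given in state space coordinates in which $\tilde Y=Q^{-1}$ and $\tilde X$ are simultaneously diagonal. *)

(* Defs.v *)
From HB Require Import structures.
From mathcomp Require Import all_boot all_order all_algebra.
From mathcomp Require Import complex.
From mathcomp Require Import all_classical all_reals all_analysis.

Set Implicit Arguments.
Unset Strict Implicit.
Unset Printing Implicit Defensive.

Import Order.TTheory GRing.Theory Num.Theory numFieldNormedType.Exports.

Local Open Scope ring_scope.

Definition psdmx (K : realType) (n : nat) (M : 'M[K]_n) : Prop :=
  M^T = M /\ forall x : 'cV[K]_n, 0 <= (x^T *m M *m x) 0 0.

Definition pdmx (K : realType) (n : nat) (M : 'M[K]_n) : Prop :=
  M^T = M /\ forall x : 'cV[K]_n, x != 0 -> 0 < (x^T *m M *m x) 0 0.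

(* The eigenvalues are the complex ones. *)
Definition hurwitz (K : realType) (n : nat) (A : 'M[K]_n) : Prop :=
  forall z : K[i], eigenvalue (map_mx (real_complex K) A) z -> complex.Re z < 0.

Definition stabilizable (K : realType) (n m : nat)
    (A : 'M[K]_n) (B : 'M[K]_(n, m)) : Prop :=
  exists F : 'M[K]_(m, n), hurwitz (A + B *m F).

(* x' = A x + f; the derivative is taken entrywise, on the whole time axis. *)
Definition solves (K : realType) (n : nat) (A : 'M[K]_n)
    (f x : K -> 'cV[K]_n) : Prop :=
  forall (t : K) (i : 'I_n),
    is_derive (t : K^o) 1 (fun s : K^o => x s i 0 : K^o) ((A *m x t + f t) i 0).

(* Inputs are continuous; for time-invariant systems a larger input class
   (piecewise continuous, locally integrable) gives the same notion. *)
Definition controllable (K : realType) (n m : nat)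
    (A : 'M[K]_n) (B : 'M[K]_(n, m)) : Prop :=
  forall (T : K) (x0 x1 : 'cV[K]_n), 0 < T ->
    exists (u : K -> 'cV[K]_m) (x : K -> 'cV[K]_n),
      [/\ forall j : 'I_m, continuous (fun t : K => u t j 0),
          solves A (fun t => B *m u t) x, x 0 = x0 & x T = x1].

(* The input contributes the same known term to both outputs, so only the
   unforced equation matters. *)
Definition observable (K : realType) (n p : nat)
    (A : 'M[K]_n) (C : 'M[K]_(p, n)) : Prop :=
  forall (T : K) (x z : K -> 'cV[K]_n), 0 < T ->
    solves A (fun=> 0) x -> solves A (fun=> 0) z ->
    (forall t : K, 0 <= t <= T -> C *m x t = C *m z t) -> x 0 = z 0.

Definition minimal (K : realType) (n m p : nat)
    (A : 'M[K]_n) (B : 'M[K]_(n, m)) (C : 'M[K]_(p, n)) : Prop :=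
  controllable A B /\ observable A C.

(* B is unconstrained: it only fixes the system x' = (J - R) Q x + B u,
   y = B^T Q x denoted by (J, R, Q, B). *)
Definition pH_system (K : realType) (n m : nat)
    (J R Q : 'M[K]_n) (B : 'M[K]_(n, m)) : Prop :=
  [/\ J = - J^T, psdmx R & pdmx Q].

Definition minimal_pH_system (K : realType) (n m : nat)
    (J R Q : 'M[K]_n) (B : 'M[K]_(n, m)) : Prop :=
  pH_system J R Q B /\ minimal ((J - R) *m Q) B (B^T *m Q).

Definition port_Hamiltonian (K : realType) (n m : nat)
    (A : 'M[K]_n) (B : 'M[K]_(n, m)) (C : 'M[K]_(m, n)) : Prop :=
  exists J R Q : 'M[K]_n,
    [/\ pH_system J R Q B, A = (J - R) *m Q & C = B^T *m Q].

Definition KYP_lmi (K : realType) (n m : nat)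
    (A : 'M[K]_n) (B : 'M[K]_(n, m)) (C : 'M[K]_(m, n)) (S : 'M[K]_n) : Prop :=
  psdmx (block_mx (- (S *m A) - A^T *m S) (C^T - S *m B)
                  (C - B^T *m S)          0).

Definition filter_eq (K : realType) (n m : nat) (gamma : K)
    (A : 'M[K]_n) (B : 'M[K]_(n, m)) (C : 'M[K]_(m, n))
    (R Q P Y : 'M[K]_n) : Prop :=
  A *m Y + Y *m A^T
  + Y *m ((gamma ^- 2 - 1) *: (C^T *m C) + gamma ^- 2 *: P) *m Y
  + (1 - gamma ^- 2) *: (B *m B^T) + 2 *: R
  - gamma ^- 2 *: (invmx Q *m P *m invmx Q) = 0.

Definition control_eq (K : realType) (n m : nat) (gamma : K)
    (A : 'M[K]_n) (B : 'M[K]_(n, m)) (C : 'M[K]_(m, n))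
    (P Y X : 'M[K]_n) : Prop :=
  let AY := A + gamma ^- 2 *: (Y *m (C^T *m C + P)) in
  AY^T *m X + X *m AY - (1 - gamma ^- 2) *: (X *m B *m B^T *m X)
  + C^T *m C + P = 0.

Definition control_stabilizing (K : realType) (n m : nat) (gamma : K)
    (A : 'M[K]_n) (B : 'M[K]_(n, m)) (C : 'M[K]_(m, n))
    (P Y X : 'M[K]_n) : Prop :=
  hurwitz (A + gamma ^- 2 *: (Y *m (C^T *m C + P))
           - (1 - gamma ^- 2) *: (B *m B^T *m X)).

(* No change of coordinates occurs: the given coordinates are the ones in which
   Y = Q^-1 and X are both diagonal. *)
Definition balanced (K : realType) (n m : nat) (gamma : K)
    (J R Q : 'M[K]_n) (B : 'M[K]_(n, m)) (P : 'M[K]_n) : Prop :=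
  let A := (J - R) *m Q in
  let C := B^T *m Q in
  let Y := invmx Q in
  filter_eq gamma A B C R Q P Y /\
  exists X : 'M[K]_n,
    [/\ control_eq gamma A B C P Y X, pdmx X,
        control_stabilizing gamma A B C P Y X, is_diag_mx Y & is_diag_mx X].

(* Main.v *)
Require Import Defs.
From HB Require Import structures.
From mathcomp Require Import all_boot all_order all_algebra.
From mathcomp Require Import complex.
From mathcomp Require Import all_classical all_reals all_analysis.

Set Implicit Arguments.
Unset Strict Implicit.
Unset Printing Implicit Defensive.

Import Order.TTheory GRing.Theory Num.Theory numFieldNormedType.Exports.

Local Open Scope ring_scope.

(** In balanced coordinates the solution [invmx Q] of the filter equation is
    diagonal; as [Q] is invertible, being definite, it is diagonal as well
    ([is_diag_mx_invmx]).  Hence [Q21 = 0], the cross term in the leading block of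
    [(J - R) *m Q] disappears, and this block is [(J11 - R11) *m Q11]; in the same
    way the first columns of [B^T *m Q] are [B1^T *m Q11].  Truncation thus
    commutes with forming the linear system from [(J, R, Q, B)], and the structure
    conditions on [J], [R] and [Q] pass to leading principal blocks. *)

(** Padding the test vectors with zeros is what transfers (semi)definiteness to
    leading principal blocks. *)
Lemma quad_form_ulsubmx (K : comNzRingType) (r k : nat) (M : 'M[K]_(r + k))
    (x : 'cV[K]_r) :
  x^T *m ulsubmx M *m x = (col_mx x 0)^T *m M *m col_mx x (0 : 'cV_k).
Proof.
rewrite -{2}(submxK M) tr_col_mx mul_row_block mul_row_col.
by rewrite trmx0 !mul0mx addr0 mulmx0 addr0.
Qed.

Lemma psdmx_ulsubmx (K : realType) (r k : nat) (M : 'M[K]_(r + k)) :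
  psdmx M -> psdmx (ulsubmx M).
Proof.
move=> [Msym Mge0]; split=> [|x]; first by rewrite trmx_ulsub Msym.
by rewrite quad_form_ulsubmx.
Qed.

Lemma pdmx_ulsubmx (K : realType) (r k : nat) (M : 'M[K]_(r + k)) :
  pdmx M -> pdmx (ulsubmx M).
Proof.
move=> [Msym Mgt0]; split=> [|x x0]; first by rewrite trmx_ulsub Msym.
by rewrite quad_form_ulsubmx Mgt0// col_mx_eq0 (negPf x0).
Qed.

Lemma pdmx_unitmx (K : realType) (n : nat) (M : 'M[K]_n) :
  pdmx M -> M \in unitmx.
Proof.
move=> [_ Mgt0]; rewrite unitmxE unitfE; apply/det0P => -[v v0 vM].
have := Mgt0 v^T; rewrite trmx_eq0 => /(_ v0).
by rewrite trmxK vM mul0mx mxE ltxx.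
Qed.

(** Column [j] of [M *m invmx M = 1] reads [M i j * invmx M j j = (i == j)], and
    the case [i = j] shows that [invmx M j j] cannot vanish. *)
Lemma is_diag_mx_invmx (K : fieldType) (n : nat) (M : 'M[K]_n) :
  M \in unitmx -> is_diag_mx (invmx M) -> is_diag_mx M.
Proof.
move=> Mu /is_diag_mxP Vdiag.
have entry i j : M i j * invmx M j j = (i == j)%:R.
  have /matrixP/(_ i j) := mulmxV Mu; rewrite !mxE (bigD1 j)//= big1 ?addr0//.
  by move=> l lj; rewrite Vdiag ?mulr0.
apply/is_diag_mxP => i j ij; have /eqP := entry i j.
have /negPf-> : i != j by [].
rewrite mulf_eq0 => /orP[/eqP//|/eqP V0].
by have /eqP := entry j j; rewrite V0 mulr0 eqxx eq_sym oner_eq0.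
Qed.

Lemma ulsubmx_mul_diag (K : comNzRingType) (r k : nat) (M D : 'M[K]_(r + k)) :
  is_diag_mx D -> ulsubmx (M *m D) = ulsubmx M *m ulsubmx D.
Proof.
rewrite -{1 2}(submxK D) is_diag_block_mx// => /and4P[_ /eqP-> _ _].
by rewrite -{1}(submxK M) mulmx_block block_mxKul mulmx0 addr0.
Qed.

Lemma lsubmx_mul_diag (K : comNzRingType) (p r k : nat) (M : 'M[K]_(p, r + k))
    (D : 'M[K]_(r + k)) :
  is_diag_mx D -> lsubmx (M *m D) = lsubmx M *m ulsubmx D.
Proof.
rewrite -{1 2}(submxK D) is_diag_block_mx// => /and4P[_ /eqP-> _ _].
by rewrite -{1}(hsubmxK M) mul_row_block row_mxKl mulmx0 addr0.
Qed.

Theorem theorem14 (K : realType) (r k m : nat)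
    (J R Q : 'M[K]_(r + k)) (B : 'M[K]_(r + k, m)) (gamma eta : K)
    (S : 'M[K]_(r + k)) :
  (1 <= r)%N -> (r < r + k)%N -> (m <= r + k)%N ->
  minimal_pH_system J R Q B ->
  let A := (J - R) *m Q in
  let C := B^T *m Q in
  let P := eta *: S in
  1 < gamma ->
  0 <= eta ->
  pdmx S ->
  KYP_lmi A B C S ->
  stabilizable (A + gamma ^- 2 *: (invmx Q *m P)) B ->
  balanced gamma J R Q B P ->
  pH_system (ulsubmx J) (ulsubmx R) (ulsubmx Q) (usubmx B) /\
  port_Hamiltonian (ulsubmx A) (usubmx B) (lsubmx C).
Proof.
move=> _ _ _ [[Jskew Rpsd Qpd] _] A C P _ _ _ _ _ [_ [X [_ _ _ Ydiag _]]].
have Qdiag : is_diag_mx Q := is_diag_mx_invmx (pdmx_unitmx Qpd) Ydiag.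
have trunc_pH :
    pH_system (ulsubmx J) (ulsubmx R) (ulsubmx Q) (usubmx B).
  split; [|exact: psdmx_ulsubmx|exact: pdmx_ulsubmx].
  by rewrite trmx_ulsub {1}Jskew; apply/matrixP => i j; rewrite !mxE.
split=> //; exists (ulsubmx J), (ulsubmx R), (ulsubmx Q); split=> //.
- rewrite /A ulsubmx_mul_diag//; congr (_ *m _).
  by apply/matrixP => i j; rewrite !mxE.
- by rewrite /C lsubmx_mul_diag// trmx_usub.
Qed.
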